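(* There exist block graphs $G$ of diameter $3$ for which the bandwidth $B(G)$ is strictly greater than the local density $\beta(G)$.
   Context: All graphs are finite and simple. A block graph is a graph in which every block (maximal 2-connected subgraph or bridge) is a clique. For an injection $f\colon V(G)\to\mathbb{Z}$, its bandwidth is $B(f)=\max_{uv\in E(G)}|f(u)-f(v)|$; the bandwidth of $G$ is $B(G)=\min_f B(f)$ over all such injections. Writing $n(H)=|V(H)|$, the local density of $G$ is $\beta(G)=\max_{H}\lceil (n(H)-1)/\operatorname{diam} H\rceil$, the maximum over connected subgraphs $H\subseteq G$ with at least two vertices. *)

(* Defs.v *)
From HB Require Import structures.
From mathcomp Require Import all_boot all_order all_algebra.
From mathcomp Require Import boolp.

Set Implicit Arguments.
Unset Strict Implicit.
Unset Printing Implicit Defensive.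

(* A finite simple graph has its vertices in an ambient finite type and its
   edges are two-element sets of vertices, so that a graph and its subgraphs
   have the same type. *)
Definition is_graph (T : finType) (D : {set T} * {set {set T}}) : bool :=
  [forall e in D.2, (e \subset D.1) && (#|e| == 2)].

Record graph (T : finType) := Graph {
  gdata : {set T} * {set {set T}};
  gdataP : is_graph gdata
}.

HB.instance Definition _ (T : finType) := [isSub for @gdata T].
HB.instance Definition _ (T : finType) := [Finite of graph T by <:].

Definition V (T : finType) (G : graph T) : {set T} := (gdata G).1.
Definition E (T : finType) (G : graph T) : {set {set T}} := (gdata G).2.

Definition adj (T : finType) (G : graph T) : rel T :=
  [rel x y | [set x; y] \in E G].

Definition subgraph (T : finType) (H G : graph T) : bool :=
  (V H \subset V G) && (E H \subset E G).

Lemma is_graph_del_vertex (T : finType) (G : graph T) (v : T) :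
  is_graph (V G :\ v, [set e in E G | v \notin e]).
Proof.
apply/forall_inP => e /=; rewrite inE => /andP[eG ve].
have /andP[eV ->] := forall_inP (gdataP G) e eG.
by rewrite subsetD1 eV ve.
Qed.

Definition del_vertex (T : finType) (G : graph T) (v : T) : graph T :=
  Graph (is_graph_del_vertex G v).

Lemma is_graph_del_edge (T : finType) (G : graph T) (e : {set T}) :
  is_graph (V G, E G :\ e).
Proof.
apply/forall_inP => e' /=; rewrite !inE => /andP[_ eG].
exact: (forall_inP (gdataP G)).
Qed.

Definition del_edge (T : finType) (G : graph T) (e : {set T}) : graph T :=
  Graph (is_graph_del_edge G e).

Definition connected (T : finType) (G : graph T) : bool :=
  [forall x in V G, forall y in V G, connect (adj G) x y].

Definition walk (T : finType) (G : graph T) (x y : T) (k : nat) : bool :=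
  [exists p : k.-tuple T, path (adj G) x p && (last x p == y)].

(* Walks of length < #|T| suffice for a shortest one; if y is not reachable
   from x the value is the junk #|T|, so dist and diam are meaningful for
   connected graphs only. *)
Definition dist (T : finType) (G : graph T) (x y : T) : nat :=
  find (walk G x y) (iota 0 #|T|).

Definition diam (T : finType) (G : graph T) : nat :=
  \max_(x in V G) \max_(y in V G) dist G x y.

Definition two_connected (T : finType) (G : graph T) : bool :=
  [&& 2 < #|V G|, connected G & [forall v in V G, connected (del_vertex G v)]].

Definition bridge (T : finType) (G : graph T) (e : {set T}) : bool :=
  (e \in E G) &&
  [exists x in e, exists y in e, ~~ connect (adj (del_edge G e)) x y].

Definition max_two_connected (T : finType) (G K : graph T) : Prop :=
  [/\ subgraph K G, two_connected K
    & forall H : graph T,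
        subgraph H G -> two_connected H -> subgraph K H -> H = K].

Definition bridge_subgraph (T : finType) (G K : graph T) : Prop :=
  exists2 e : {set T}, bridge G e & V K = e /\ E K = [set e].

Definition block (T : finType) (G K : graph T) : Prop :=
  max_two_connected G K \/ bridge_subgraph G K.

Definition clique (T : finType) (K : graph T) : Prop :=
  {in V K &, forall x y : T, x != y -> adj K x y}.

(* Isolated vertices, which some authors also count as blocks, are trivially
   cliques. *)
Definition block_graph (T : finType) (G : graph T) : Prop :=
  forall K : graph T, block G K -> clique K.

(* Only the values of f on V G matter. *)
Definition width (T : finType) (G : graph T) (f : T -> int) : nat :=
  \max_(x in V G) \max_(y in V G | adj G x y) `|(f x - f y)%R|%N.

Definition achieves_width (T : finType) (G : graph T) (b : nat) : Prop :=
  exists2 f : T -> int, {in V G &, injective f} & width G f = b.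

Lemma achieves_width_ex (T : finType) (G : graph T) :
  exists b : nat, `[< achieves_width G b >].
Proof.
pose f (x : T) : int := Posz (enum_rank x).
exists (width G f); apply/asboolP; exists f => //.
by move=> x y _ _ [] /val_inj /enum_rank_inj.
Qed.

Definition bandwidth (T : finType) (G : graph T) : nat :=
  ex_minn (achieves_width_ex G).

Definition ceil_divn (m d : nat) : nat := (m + d.-1) %/ d.

Lemma ceil_divn_leq (m d k : nat) :
  0 < d -> (ceil_divn m d <= k) = (m <= k * d).
Proof.
case: d => // d _.
by rewrite /ceil_divn -ltnS ltn_divLR //= mulSn addnC addSn ltnS leq_add2l.
Qed.

(* Subgraphs are arbitrary, not only induced, and diam H is measured in H. *)
Definition local_density (T : finType) (G : graph T) : nat :=
  \max_(H : graph T | [&& subgraph H G, connected H & 1 < #|V H|])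
    ceil_divn #|V H|.-1 (diam H).

(* Main.v *)
Require Import Defs.
From mathcomp Require Import all_boot all_order all_algebra.
From mathcomp Require Import boolp zify.

(** Let [G] be a [K_4] with a triangle hung on three of its four vertices: it has
    10 vertices and local density 3. In a numbering of width 3 the diameter
    forces the labels to be [m, ..., m + 9], and the vertices of the [K_4] to
    occupy [m + 3, ..., m + 6]. The other two vertices of a triangle are adjacent,
    hence both to the left or both to the right of the [K_4], so that the
    number of labels to the left of the [K_4] is even; but it is 3. *)

Set Implicit Arguments.
Unset Strict Implicit.
Unset Printing Implicit Defensive.

Import Order.TTheory GRing.Theory Num.Theory.

(** * Distance, 2-connectedness and width in arbitrary graphs *)

Section GraphTheory.
Variable T : finType.
Implicit Types (G H K : graph T) (x y v : T) (k : nat).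

Lemma edge_sub G e : e \in E G -> e \subset V G.
Proof. by move=> /(forall_inP (gdataP G)) /andP[]. Qed.

Lemma adj_subgraph H G : subgraph H G -> subrel (adj H) (adj G).
Proof. by case/andP=> _ /subsetP sE x y /sE. Qed.

(** The bound on [k] excludes the junk value [#|T|] that [dist] takes on unreachable pairs. *)
Lemma dist_leP G x y k : k < #|T| ->
  reflect (exists p, [/\ path (adj G) x p, last x p = y & size p <= k])
          (dist G x y <= k).
Proof.
move=> ltk; rewrite -ltnS /dist -has_take_leq ?size_iota // take_iota.
rewrite (minn_idPl ltk); apply: (iffP hasP) => [[j]|[p [xp yp sp]]].
  rewrite mem_iota ltnS /= => lejk /existsP[p /andP[xp /eqP yp]].
  by exists p; rewrite size_tuple.
exists (size p); first by rewrite mem_iota ltnS.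
by apply/existsP; exists (in_tuple p); rewrite xp yp eqxx.
Qed.

Lemma diam_leP G k :
  reflect {in V G &, forall x y, dist G x y <= k} (diam G <= k).
Proof.
apply: (iffP (bigmax_leqP _ _ _)) => le_k x.
  by move=> y xV yV; apply: (bigmax_leqP _ _ _ (le_k x xV)).
by move=> xV; apply/bigmax_leqP => y; apply: le_k.
Qed.

Lemma adj_del_vertex K v x y :
  adj (del_vertex K v) x y = [&& adj K x y, x != v & y != v].
Proof. by rewrite /adj /= {1}/E /= inE !inE negb_or ![v == _]eq_sym. Qed.

Lemma connect_del_vertex K x y v : two_connected K ->
    x \in V K -> y \in V K -> x != v -> y != v ->
  connect (adj (del_vertex K v)) x y.
Proof.
case/and3P=> _ cK /forall_inP c2K xK yK nxv nyv.
(* If [v] lies outside [K], deleting it removes no edge. *)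
have [vK | nvK] := boolP (v \in V K).
  apply: (forall_inP (forall_inP (c2K v vK) x _)).
    by rewrite /V /= !inE nxv xK.
  by rewrite /V /= !inE nyv yK.
apply: connect_sub (forall_inP (forall_inP cK x xK) y yK) => a b abK.
apply: connect1; rewrite adj_del_vertex abK /=.
have /subsetP sV := edge_sub abK.
by apply/andP; split; apply: contraNneq nvK => <-; apply: sV; rewrite !inE eqxx ?orbT.
Qed.

Definition induced_edges G (A : {set T}) := [set e in E G | e \subset A].

Lemma is_graph_induced G (A : {set T}) : is_graph (A, induced_edges G A).
Proof.
apply/forall_inP => e /=; rewrite inE => /andP[eG ->].
by have /andP[] := forall_inP (gdataP G) e eG.
Qed.

Definition induced G A : graph T := Graph (is_graph_induced G A).

Lemma subgraph_induced K G : subgraph K G -> subgraph K (induced G (V K)).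
Proof.
case/andP=> _ /subsetP sE; rewrite /subgraph subxx /=.
by apply/subsetP => e eK; rewrite inE sE ?edge_sub.
Qed.

Lemma connected_spanning K H :
  V K = V H -> E K \subset E H -> connected K -> connected H.
Proof.
rewrite /connected => <- /subsetP sE cK.
apply/forall_inP => x xK; apply/forall_inP => y yK.
apply: connect_sub (forall_inP (forall_inP cK x xK) y yK) => a b /sE.
exact: connect1.
Qed.

Lemma two_connected_spanning K H :
  V K = V H -> E K \subset E H -> two_connected K -> two_connected H.
Proof.
move=> eV sE /and3P[V2 cK /forall_inP c2K].
rewrite /two_connected -eV V2 (connected_spanning eV sE) //=.
apply/forall_inP => v /c2K; apply: connected_spanning; first by rewrite /V /= -!/(V _) eV.
by apply/subsetP => e; rewrite /E /= !inE -!/(E _) => /andP[/(subsetP sE) -> ].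
Qed.

(** Adding edges on the same vertices preserves 2-connectedness, so a maximal [K] equals the
    subgraph of [G] induced on its vertices. *)
Lemma adj_max_two_connected G K x y : max_two_connected G K ->
  x \in V K -> y \in V K -> adj G x y -> adj K x y.
Proof.
case=> sKG K2 maxK xK yK xy.
have sKI := subgraph_induced sKG.
have <- : induced G (V K) = K.
  apply: maxK => //.
    apply/andP; split; first by case/andP: sKG.
    by apply/subsetP => e; rewrite inE => /andP[].
  by apply: two_connected_spanning K2 => //; case/andP: sKI.
rewrite /adj /= /E /= inE; apply/andP; split=> //.
by apply/subsetP => z; rewrite !inE => /orP[] /eqP ->.
Qed.

Lemma bridge_subgraph_clique G K : bridge_subgraph G K -> clique K.
Proof.
case=> e /andP[eG _] [VK EK] x y; rewrite VK => xe ye nxy.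
rewrite /adj /= EK inE eqEcard subUset !sub1set xe ye /=.
by have /andP[_ /eqP ->] := forall_inP (gdataP G) e eG; rewrite cards2 nxy.
Qed.

Lemma width_leP G (f : T -> int) k :
  reflect (forall x y, adj G x y -> `|(f x - f y)%R|%N <= k) (width G f <= k).
Proof.
apply: (iffP (bigmax_leqP _ _ _)) => le_k.
  move=> x y xy; have /subsetP sV := edge_sub xy.
  have xV : x \in V G by apply: sV; rewrite !inE eqxx.
  have yV : y \in V G by apply: sV; rewrite !inE eqxx orbT.
  by apply: (bigmax_leqP _ _ _ (le_k x xV)); rewrite yV.
by move=> x _; apply/bigmax_leqP => y /andP[_ /le_k].
Qed.

End GraphTheory.

(** * Cliques hung on a central clique *)

(* The fixed points of [hub] are pairwise adjacent, and each fibre of [hub] is a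
   clique hung on its fixed point. *)
Section HubGraph.
Variables (T : finType) (hub : T -> T).
Hypothesis hubK : forall x, hub (hub x) = hub x.

(** The reflexive closure of adjacency: reflexivity allows walks that stand still, which spares case
    distinctions on coinciding vertices. *)
Definition hub_rel (x y : T) : bool :=
  (hub x == hub y) || (hub x == x) && (hub y == y).

Definition hub_edges : {set {set T}} :=
  [set e : {set T} | (#|e| == 2) && [forall x in e, forall y in e, hub_rel x y]].

Lemma is_graph_hub : is_graph ([set: T], hub_edges).
Proof. by apply/forall_inP => e; rewrite inE => /andP[-> _]; rewrite subsetT. Qed.

Definition hub_graph : graph T := Graph is_graph_hub.

Local Notation G := hub_graph.

Lemma hub_relxx x : hub_rel x x.
Proof. by rewrite /hub_rel eqxx. Qed.

Lemma hub_relC x y : hub_rel x y = hub_rel y x.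
Proof. by rewrite /hub_rel eq_sym andbC. Qed.

Lemma hub_adjE x y : adj G x y = (x != y) && hub_rel x y.
Proof.
rewrite /adj /E /= inE cards2; case: (eqVneq x y) => //= _.
apply/idP/idP => [|xy].
  by move=> /forall_inP/(_ x (set21 x y))/forall_inP/(_ y (set22 x y)).
apply/forall_inP => a axy; apply/forall_inP => b.
move: axy; rewrite !inE => /orP[] /eqP -> /orP[] /eqP ->;
  by rewrite ?hub_relxx // hub_relC.
Qed.

Lemma hub_rel_hub x : hub_rel x (hub x).
Proof. by rewrite /hub_rel hubK eqxx. Qed.

Lemma hub_rel_hubs x y : hub_rel (hub x) (hub y).
Proof. by rewrite /hub_rel !hubK !eqxx orbT. Qed.

Lemma hub_rel_pendant x y : hub x != x -> hub_rel x y -> hub y = hub x.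
Proof. by rewrite /hub_rel => /negPf -> /orP[/eqP|]. Qed.

(* The pendant vertices at a hub [v] cannot be left without going through [v]. *)
Lemma two_connected_hub_rel K x y : subgraph K G -> two_connected K ->
  x \in V K -> y \in V K -> hub_rel x y.
Proof.
move=> sKG K2.
have pendant a b : a \in V K -> b \in V K -> hub a != a -> hub_rel a b.
  move=> aK bK na; rewrite /hub_rel.
  have [-> | nb] := eqVneq b (hub a); first by rewrite hubK eqxx.
  have := connect_del_vertex K2 aK bK _ nb; rewrite eq_sym => /(_ na).
  set v := hub a => ab.
  (* An edge between distinct fibres joins two fixed points; one of them lying in this set would
     equal [v], which is deleted. *)
  have clS : closed (adj (del_vertex K v)) [pred z | (z != v) && (hub z == v)].
    move=> z t; rewrite adj_del_vertex => /and3P[/(adj_subgraph sKG)].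
    rewrite hub_adjE !inE => /andP[_ zt] zv tv; rewrite zv tv /=.
    case/orP: zt => [/eqP-> //|/andP[/eqP-> /eqP->]].
    by rewrite (negPf zv) (negPf tv).
  have := closed_connect clS ab; rewrite !inE /= eq_sym na eqxx nb /=.
  by rewrite eq_sym => <-.
move=> xK yK; have [hx | nx] := eqVneq (hub x) x; last exact: pendant.
have [hy | ny] := eqVneq (hub y) y; first by rewrite /hub_rel hx hy !eqxx orbT.
by rewrite hub_relC; apply: pendant.
Qed.

Lemma block_hub_graph : block_graph G.
Proof.
move=> K [maxK | ]; last exact: bridge_subgraph_clique.
move=> x y xK yK nxy; have [sKG K2 _] := maxK.
apply: (adj_max_two_connected maxK) => //.
by rewrite hub_adjE nxy (two_connected_hub_rel sKG).
Qed.

Lemma shorten_hub_path x p : path hub_rel x p ->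
  exists q, [/\ path (adj G) x q, last x q = last x p & size q <= size p].
Proof.
elim: p x => [|y p IHp] x /=; first by exists [::].
case/andP=> xy /IHp[q [yq eq_last le_size]].
have [exy | nxy] := eqVneq x y.
  by subst y; exists q; split=> //; apply: leqW.
by exists (y :: q); rewrite /= hub_adjE nxy xy.
Qed.

Lemma hub_path x y : path hub_rel x [:: hub x; hub y; y].
Proof. by rewrite /= /hub_rel !hubK !eqxx !orbT. Qed.

Lemma connected_hub_graph : connected G.
Proof.
apply/forall_inP => x _; apply/forall_inP => y _.
have [q [xq yq _]] := shorten_hub_path (hub_path x y).
by apply/connectP; exists q.
Qed.

Lemma diam_hub_graph : 3 < #|T| -> diam G <= 3.
Proof.
move=> T3; apply/diam_leP => x y _ _; apply/(dist_leP _ _ _ T3).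
exact: shorten_hub_path (hub_path x y).
Qed.

Lemma dist1_hub_rel H x y : 1 < #|T| -> subgraph H G ->
  dist H x y <= 1 -> hub_rel x y.
Proof.
move=> T1 sHG /(dist_leP _ _ _ T1) [p [/(sub_path (adj_subgraph sHG))]].
case: p => [|a [|b p]] //=; first by move=> _ -> _; apply: hub_relxx.
by rewrite andbT hub_adjE => /andP[_ xa] <-.
Qed.

(** The first edge out of a pendant vertex stays in its fibre, and so does the last edge into one;
    hence the middle vertex of a walk of length 2 shares its hub with both ends. *)
Lemma dist2_pendant H x y : 2 < #|T| -> subgraph H G ->
  hub x != x -> hub y != y -> dist H x y <= 2 -> hub x = hub y.
Proof.
move=> T2 sHG nx ny /(dist_leP _ _ _ T2) [p [/(sub_path (adj_subgraph sHG))]].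
have adj_rel a b : adj G a b -> hub_rel a b by rewrite hub_adjE => /andP[].
case: p => [|a [|b [|c p]]] //=; first by move=> _ ->.
  by rewrite andbT => /adj_rel/(hub_rel_pendant nx) <- <-.
case/and3P=> /adj_rel/(hub_rel_pendant nx) <- /adj_rel ab _ eby _; subst b.
by apply: hub_rel_pendant; rewrite // hub_relC.
Qed.

Definition hubs : {set T} := [set x | hub x == x].

Definition spokes (v : T) : {set T} := [set x | hub x == v].

(** A pendant vertex of [H] forces all of [H] into its own fibre; without one, [H] consists of
    hubs. *)
Lemma diam1_card H k : 1 < #|T| -> subgraph H G -> diam H <= 1 ->
  #|hubs| <= k -> (forall v, #|spokes v| <= k) -> #|V H| <= k.
Proof.
move=> T1 sHG /diam_leP d1 lehk lesk.
have [/subset_leq_card/leq_trans-> // | /subsetPn[x xH]] := boolP (V H \subset hubs).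
rewrite inE => nx; apply: leq_trans (lesk (hub x)).
apply/subset_leq_card/subsetP => y yH; rewrite inE; apply/eqP.
exact/(hub_rel_pendant nx)/(dist1_hub_rel T1 sHG)/d1.
Qed.

(** All pendant vertices of [H] share one hub, so [H] is covered by the hubs and a single fibre. *)
Lemma diam2_card H k : 2 < #|T| -> subgraph H G -> diam H <= 2 ->
  (forall v, #|spokes v| <= k) -> #|V H| <= #|hubs| + k.
Proof.
move=> T2 sHG /diam_leP d2 lesk.
have [/subset_leq_card/leq_trans-> // | /subsetPn[x xH]] := boolP (V H \subset hubs).
  exact: leq_addr.
rewrite inE => nx; apply: leq_trans (leq_add (leqnn _) (lesk (hub x))).
apply: leq_trans (leq_of_leqif (leq_card_setU _ _)).
apply/subset_leq_card/subsetP => y yH; rewrite !inE -implyNb.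
apply/implyP=> ny; apply/eqP/esym.
exact: dist2_pendant (d2 x y xH yH).
Qed.

End HubGraph.

(** * The graph on ten vertices *)

(* The [K_4] is on [0..3]; for [0 < i < 4] the vertices [2i + 2] and [2i + 3] complete
   the triangle at [i]. *)
Definition hub10 (x : 'I_10) : 'I_10 := inord (if x < 4 then x : nat else (x - 2)./2).

Lemma hub10E (x : 'I_10) : hub10 x = (if x < 4 then x : nat else (x - 2)./2) :> nat.
Proof. by rewrite /hub10 inordK //; case: x => x /= ltx; case: ifP; lia. Qed.

Lemma hub10K x : hub10 (hub10 x) = hub10 x.
Proof.
by apply: val_inj; rewrite /= !hub10E; case: x => x /= ltx; do ?case: ifP; lia.
Qed.

Lemma hub10_fix x : (hub10 x == x) = (x < 4).
Proof. by rewrite -val_eqE /= hub10E; case: x => x /= ltx; case: ifP; lia. Qed.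

Lemma card_set_ord n (A : {set 'I_n}) : #|A| = \sum_(i < n) (i \in A).
Proof. by rewrite -sum1_card big_mkcond; apply: eq_bigr => i _; case: (_ \in _). Qed.

Lemma card_hubs10 : #|hubs hub10| = 4.
Proof.
rewrite card_set_ord; under eq_bigr do rewrite inE hub10_fix.
by rewrite !big_ord_recl big_ord0.
Qed.

Lemma card_spokes10 v : #|spokes hub10 v| <= 3.
Proof.
rewrite card_set_ord; under eq_bigr do rewrite inE -val_eqE /= hub10E.
by rewrite !big_ord_recl big_ord0; case: v => [[|[|[|[|v]]]] ltv].
Qed.

Local Notation G10 := (hub_graph hub10).

Lemma diam_hub10 : diam G10 = 3.
Proof.
apply/eqP; rewrite eqn_leq diam_hub_graph ?card_ord //=; last exact: hub10K.
rewrite ltnNge; apply/diam_leP => d2.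
(* The vertices 4 and 6 are pendant at the distinct hubs 1 and 2. *)
have d46 : dist G10 (inord 4) (inord 6) <= 2 by apply: d2; rewrite inE.
suff: hub10 (inord 4) = hub10 (inord 6).
  by move/(congr1 val); rewrite /= !hub10E !inordK.
apply: dist2_pendant d46; rewrite ?card_ord ?hub10_fix ?inordK //.
by rewrite /subgraph !subxx.
Qed.

Lemma local_density_hub10 : local_density G10 <= 3.
Proof.
apply/bigmax_leqP => H /and3P[sHG _ _].
(* It suffices to have at most 4, 7 and 10 vertices for diameters 1, 2 and at least 3. *)
have le3 d : 0 < d -> #|V H| <= (3 * d).+1 -> ceil_divn #|V H|.-1 d <= 3.
  by move=> d0; rewrite ceil_divn_leq //; lia.
have le10 := leq_trans (max_card (V H)) (eq_leq (card_ord 10)).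
case d_eq: (diam H) => [|[|[|d]]].
(* Division by zero yields 0. *)
- by rewrite /ceil_divn divn0.
- apply: le3 => //; apply: (diam1_card _ sHG).
  + by rewrite card_ord.
  + by rewrite d_eq.
  + by rewrite card_hubs10.
  + by move=> v; apply: leq_trans (card_spokes10 v) _.
- apply: le3 => //; have := diam2_card _ sHG _ card_spokes10.
  by rewrite card_hubs10 card_ord d_eq; apply.
- by apply: le3 => //; lia.
Qed.

Lemma width_hub10 (f : 'I_10 -> int) : injective f -> 3 < width G10 f.
Proof.
move=> finj; rewrite ltnNge; apply/width_leP => w3.
have near3 x y : hub_rel hub10 x y -> (`|f x - f y| <= 3)%R.
  move=> xy; have [-> | nxy] := eqVneq x y; first by rewrite subrr normr0.
  by have := w3 x y; rewrite hub_adjE nxy xy => /(_ isT); lia.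
have near_hub x := near3 _ _ (hub_rel_hub hub10K x).
have near_hubs x y := near3 _ _ (hub_rel_hubs hub10K x y).
have [x0 _ minx0] := arg_minP f (erefl : xpredT (ord0 : 'I_10)).
have ge0 x : (0 <= f x - f x0)%R by have := minx0 x isT; lia.
(* The chain from [x] through [hub10 x] and [hub10 x0] to [x0] has three steps of at most 3 each. *)
have lt10 x : `|(f x - f x0)%R| < 10.
  by move: (near_hub x) (near_hub x0) (near_hubs x x0) (ge0 x); lia.
pose g x : 'I_10 := Ordinal (lt10 x).
have gE x : Posz (g x) = (f x - f x0)%R by rewrite /= gez0_abs.
have ginj : injective g.
  by move=> x y exy; apply: finj; move: (gE x) (gE y); rewrite exy; lia.
have [h gK hK] := injF_bij ginj.
(* A hub is at most two steps, hence 6, away from the vertices labelled 0 and 9. *)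
have hubs_mid (x : 'I_10) : x < 4 -> 3 <= g x <= 6.
  rewrite -hub10_fix => /eqP hx.
  move: (near_hub x0) (near_hubs x x0) (near_hub (h ord_max)) (near_hubs x (h ord_max)).
  by move: (gE (h ord_max)) (gE x); rewrite hK hx /=; lia.
(* The four hubs have distinct labels among 3, 4, 5, 6, so they use up all four. *)
have mid_hubs (x : 'I_10) : 3 <= g x <= 6 -> x < 4.
  suff /setP/(_ (g x)) : g @: hubs hub10 = [set i : 'I_10 | 3 <= i <= 6].
    by rewrite mem_imset // !inE hub10_fix => ->.
  apply/eqP; rewrite eqEcard card_imset // card_hubs10; apply/andP; split.
    by apply/subsetP => _ /imsetP[y + ->]; rewrite !inE hub10_fix; apply: hubs_mid.
  by rewrite card_set_ord; under eq_bigr do rewrite inE; rewrite !big_ord_recl big_ord0.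
pose L := [set x : 'I_10 | g x < 3].
have cardL : #|L| = 3.
  have -> : L = g @^-1: [set i : 'I_10 | i < 3] by apply/setP => x; rewrite !inE.
  rewrite card_preimset //.
  by rewrite card_set_ord; under eq_bigr do rewrite inE; rewrite !big_ord_recl big_ord0.
have hubsL (x : 'I_10) : x < 4 -> (x \in L) = false.
  by move=> /hubs_mid; rewrite inE; lia.
(* Pendant labels are at most 2 or at least 7, and a gap of 5 is too wide for two vertices of one
   triangle. *)
have mateL (x y : 'I_10) : 4 <= x -> 4 <= y -> hub10 x = hub10 y ->
    (x \in L) = (y \in L).
  move=> x4 y4 hxy; have := near3 x y; rewrite /hub_rel hxy eqxx => /(_ isT).
  by move: (gE x) (gE y) (mid_hubs x) (mid_hubs y); rewrite !inE; lia.
(* Indexing by natural numbers lets the terms of the expanded sum be rewritten one by one. *)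
pose l i : bool := inord i \in L.
have hub_l i : i < 4 -> l i = false.
  by move=> lti; apply: hubsL; rewrite inordK //; apply: leq_trans lti _.
have mate_l i : i < 3 -> l (i.*2 + 5) = l (i.*2 + 4).
  move=> lti; have [lt4 lt5] : i.*2 + 4 < 10 /\ i.*2 + 5 < 10 by lia.
  apply: mateL; rewrite ?inordK //; try lia.
  by apply: val_inj; rewrite /= !hub10E !inordK // !ifN; lia.
have := cardL; rewrite card_set_ord.
rewrite (eq_bigr (fun i : 'I_10 => l i : nat)) => [|i _]; last by rewrite /l inord_val.
rewrite !big_ord_recl big_ord0 /= /bump /= !add1n.
rewrite (hub_l 0) // (hub_l 1) // (hub_l 2) // (hub_l 3) //.
rewrite (mate_l 0 isT : l 5 = _) (mate_l 1 isT : l 7 = _) (mate_l 2 isT : l 9 = _).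
(* What remains equates twice the sum of [l 4], [l 6] and [l 8] with 3. *)
by case: (l 4); case: (l 6); case: (l 8).
Qed.

Theorem theorem1 :
  exists (T : finType) (G : graph T),
    [/\ block_graph G, connected G, diam G = 3
      & local_density G < bandwidth G].
Proof.
exists 'I_10, G10; split.
- exact: block_hub_graph hub10K.
- exact: connected_hub_graph hub10K.
- exact: diam_hub10.
apply: leq_ltn_trans local_density_hub10 _; rewrite /bandwidth.
case: ex_minnP => b /asboolP[f finj <-] _; apply: width_hub10.
by move=> x y; apply: finj; rewrite inE.
Qed.
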